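(* Let $X\neq\{0\}$ be a real Hilbert space, let $m\geq 3$ be an integer, $I=\{1,\ldots,m\}$, let $A_1,\ldots,A_m$ be maximally monotone operators on $X$, and suppose that $\lambda_i=\tfrac1m$ for every $i\in I$. Put $\mu_i=1-\lambda_i$ for $i\in I$, $J_A=\sum_{i\in I}\lambda_iJ_{A_i}$, $\mathbf{X}=X^m$, and define $$\mathbf{R}\colon\mathbf{X}\to\mathbf{X}\colon(x_i)_{i\in I}\mapsto\Big(\sum_{j\in I\smallsetminus\{i\}}\frac{\lambda_j}{\mu_i}x_j\Big)_{i\in I},\qquad \mathbf{J}\colon\mathbf{X}\to\mathbf{X}\colon(x_i)_{i\in I}\mapsto\big(J_{\mu_i^{-1}A_i}x_i\big)_{i\in I},$$ $$\mathbf{S}=\Big\{(x_i)_{i\in I}\in\mathbf{X}\;\Big|\;(\forall i\in I)\;\;x_i=J_{\mu_i^{-1}A_i}\Big(\sum_{j\in I\smallsetminus\{i\}}\frac{\lambda_j}{\mu_i}x_j\Big)\Big\}.$$ Let $\mathbf{x}_0=(x_{0,i})_{i\in I}\in\mathbf{X}$ and generate the sequence $(\mathbf{x}_n)_{n\in\mathbb{N}}$, with $\mathbf{x}_n=(x_{n,i})_{i\in I}$, by $$(\forall n\in\mathbb{N})\quad \mathbf{x}_{n+1}=(\mathbf{J}\circ\mathbf{R})\mathbf{x}_n.$$ Then exactly one of the following holds. (i) $\operatorname{Fix}J_A\neq\varnothing$, $(\mathbf{x}_n)_{n\in\mathbb{N}}$ converges weakly to a point $\mathbf{x}=(x_i)_{i\in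 I}$ in $\mathbf{S}$, and $\big(\sum_{i\in I}\lambda_ix_{n,i}\big)_{n\in\mathbb{N}}$ converges weakly to $\sum_{i\in I}\lambda_ix_i\in\operatorname{Fix}J_A$. (ii) $\operatorname{Fix}J_A=\varnothing$ and $\|\mathbf{x}_n\|\to+\infty$.
   Context: A set-valued operator $B\colon X\rightrightarrows X$ is monotone if $\langle x-y,u-v\rangle\geq 0$ whenever $u\in Bx$ and $v\in By$; it is maximally monotone if it is monotone and no proper extension of (the graph of) $B$ is monotone. For a maximally monotone operator $B$ on $X$, its resolvent is $J_B=(\operatorname{Id}+B)^{-1}$, which is a single-valued mapping defined on all of $X$. For $T\colon X\to X$, $\operatorname{Fix}T=\{x\in X\mid x=Tx\}$. The product $\mathbf{X}=X^m$ is a Hilbert space with inner product $\langle\mathbf{x},\mathbf{y}\rangle=\sum_{i\in I}\langle x_i,y_i\rangle$ and the corresponding norm. The mapping $J_A=\sum_{i\in I}\lambda_iJ_{A_i}$ is the resolvent of the maximally monotone operator $A=\big(\sum_{i\in I}\lambda_iJ_{A_i}\big)^{-1}-\operatorname{Id}$. *)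

(* Defs.v *)
From HB Require Import structures.
From mathcomp Require Import all_boot all_order all_algebra.
From mathcomp Require Import all_classical all_reals all_analysis.
Import Order.TTheory GRing.Theory Num.Theory.
Import numFieldNormedType.Exports.

Set Implicit Arguments.
Unset Strict Implicit.
Unset Printing Implicit Defensive.

Local Open Scope classical_set_scope.
Local Open Scope ring_scope.

(* A set-valued operator on V is a map B : V -> set V; B x u means u \in Bx. *)

Definition monotone (R : numDomainType) (V : zmodType) (ip : V -> V -> R)
    (B : V -> set V) : Prop :=
  forall x y u v, B x u -> B y v -> 0 <= ip (x - y) (u - v).

Definition maximally_monotone (R : numDomainType) (V : zmodType)
    (ip : V -> V -> R) (B : V -> set V) : Prop :=
  monotone ip B /\
  forall C : V -> set V,
    monotone ip C -> (forall x, B x `<=` C x) -> forall x, C x = B x.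

Definition op_id (V : Type) : V -> set V := fun x => [set x].

Definition op_add (V : zmodType) (B C : V -> set V) : V -> set V :=
  fun x => [set u + v | u in B x & v in C x].

Definition op_scale (R : pzRingType) (V : lmodType R) (c : R)
    (B : V -> set V) : V -> set V :=
  fun x => [set c *: u | u in B x].

Definition op_inv (V : Type) (B : V -> set V) : V -> set V :=
  fun u => [set x | B x u].

(* (Id + B)^-1 as a function. For maximally monotone B the set below is a
   singleton for every x (Minty), so the default value 0 is never used. *)
Definition resolvent (V : zmodType) (B : V -> set V) (x : V) : V :=
  xget 0 (op_inv (op_add (@op_id V) B) x).

Definition Fix (V : Type) (T : V -> V) : set V := [set x | x = T x].

(* Convergence in the weak topology, i.e. the coarsest topology making every
   x |-> <x, y> continuous (by Riesz, these are all continuous linear forms). *)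
Definition weak_cvg (R : realType) (V : Type) (ip : V -> V -> R)
    (x : nat -> V) (l : V) : Prop :=
  forall y : V, ip (x n) y @[n --> \oo] --> ip l y.

Definition prod_ip (R : realType) (V : Type) (m : nat) (ip : V -> V -> R)
    (x y : 'I_m -> V) : R :=
  \sum_(i < m) ip (x i) (y i).

Definition prod_norm (R : realType) (V : Type) (m : nat) (ip : V -> V -> R)
    (x : 'I_m -> V) : R :=
  Num.sqrt (prod_ip ip x x).

Definition mu (R : realType) (m : nat) (lam : 'I_m -> R) (i : 'I_m) : R :=
  1 - lam i.

Definition J_avg (R : realType) (V : lmodType R) (m : nat) (lam : 'I_m -> R)
    (A : 'I_m -> V -> set V) (x : V) : V :=
  \sum_(i < m) lam i *: resolvent (A i) x.

Definition bold_R (R : realType) (V : lmodType R) (m : nat)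
    (lam : 'I_m -> R) (x : 'I_m -> V) : 'I_m -> V :=
  fun i => \sum_(j < m | j != i) (lam j / mu lam i) *: x j.

Definition bold_J (R : realType) (V : lmodType R) (m : nat)
    (lam : 'I_m -> R) (A : 'I_m -> V -> set V) (x : 'I_m -> V) : 'I_m -> V :=
  fun i => resolvent (op_scale (mu lam i)^-1 (A i)) (x i).

Definition bold_S (R : realType) (V : lmodType R) (m : nat)
    (lam : 'I_m -> R) (A : 'I_m -> V -> set V) : set ('I_m -> V) :=
  [set x | forall i, x i = resolvent (op_scale (mu lam i)^-1 (A i))
                             (\sum_(j < m | j != i) (lam j / mu lam i) *: x j)].

Definition exactly_one (P Q : Prop) : Prop := (P \/ Q) /\ ~ (P /\ Q).

(* Main.v *)
Require Import Defs.
From HB Require Import structures.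
From mathcomp Require Import all_boot all_order all_algebra.
From mathcomp Require Import all_classical all_reals all_analysis.
From mathcomp Require Import ring lra.
Import Order.TTheory GRing.Theory Num.Theory.
Import numFieldNormedType.Exports.
Local Open Scope classical_set_scope.
Local Open Scope ring_scope.

(** Write [T] for the composition of [bold_J] and [bold_R] on [X^m], so that
    the sequence is an orbit of [T] and [bold_S] is the set of fixed points of
    [T]. Spelling out the resolvents, [x] lies in [bold_S] if and only if
    [x i = resolvent (A i) z] for all [i], where [z] is the mean of [x]
    ([bold_SP]). Hence taking means maps [bold_S] to [Fix (J_avg lam A)],
    conversely a fixed point of [J_avg lam A] yields a point of [bold_S], and
    the two sets are empty simultaneously.

    The operator [bold_R] is linear and symmetric, with eigenvalues [1] and
    [- 1 / (m - 1)]. For [3 <= m] the latter is at least [- 1 / 2], which keeps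
    it away from [-1] and makes [bold_R] averaged ([bold_R_averaged]); since
    [bold_J] is firmly nonexpansive, [T] is averaged too ([bold_JR_averaged]).

    The dichotomy then holds for every averaged operator on a Hilbert space. If
    [T] has a fixed point, the steps of the orbit tend to [0], all its weak
    cluster points are fixed points, and Opial's argument shows that there is
    only one ([averaged_weak_cvg]). If [T] has no fixed point
    ([averaged_norm_cvgy]), there are two cases. The lengths of the steps
    decrease; if their limit is positive, the steps become parallel and the
    orbit escapes linearly ([averaged_escape]). If their limit is [0] and the
    norms do not tend to infinity, the orbit has a weak cluster point, a fixed
    point by demiclosedness of [Id - T] ([averaged_demiclosed]).

    Two facts about Hilbert spaces are needed. Weak compactness of bounded sets
    is used in the form [weakly_ultracompact] and follows from the Riesz
    representation theorem. That the resolvents are defined everywhere is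
    Minty's theorem, proved by minimizing the Fitzpatrick function plus half the
    squared norm. Both come from [quadratic_minimizer]: a strongly convex
    objective attains its infimum on a closed convex set. *)

(** * Inner products *)

Section InnerProduct.
Context {R : realType} {V : lmodType R} (ip : {dot V for idfun}).
Implicit Types x y : V.

Lemma dotC x y : ip x y = ip y x.
Proof. by rewrite hermC /= expr0 mul1r. Qed.

Lemma dotDl x y z : ip (x + y) z = ip x z + ip y z.
Proof. exact: linearDl. Qed.

Lemma dotDr x y z : ip x (y + z) = ip x y + ip x z.
Proof. exact: linearDr. Qed.

Lemma dotNl x y : ip (- x) y = - ip x y.
Proof. exact: linearNl. Qed.

Lemma dotNr x y : ip x (- y) = - ip x y.
Proof. exact: linearNr. Qed.

Lemma dotZl a x y : ip (a *: x) y = a * ip x y.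
Proof. by rewrite linearZl_LR. Qed.

Lemma dotZr a x y : ip x (a *: y) = a * ip x y.
Proof. by rewrite linearZr_LR. Qed.

Lemma dot0l x : ip 0 x = 0.
Proof. exact: linear0l. Qed.

Lemma dot0r x : ip x 0 = 0.
Proof. exact: linear0r. Qed.

(** Bilinear expansion. *)
Definition dotE := (dotDl, dotDr, dotNl, dotNr, dotZl, dotZr, dot0l, dot0r).

Lemma dot_ge0 x : 0 <= ip x x.
Proof.
have [->|x0] := eqVneq x 0; first by rewrite dot0l.
by rewrite ltW// neq0_dnorm_gt0.
Qed.

Lemma dot_eq0 x : ip x x <= 0 -> x = 0.
Proof.
apply: contraTeq => x0.
by rewrite -ltNge neq0_dnorm_gt0.
Qed.

Lemma dot_sqrB x y : ip (x - y) (x - y) = ip x x - 2 * ip x y + ip y y.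
Proof. rewrite !dotE (dotC y x) /=; ring. Qed.

Lemma dot_sqrD x y : ip (x + y) (x + y) = ip x x + 2 * ip x y + ip y y.
Proof. rewrite !dotE (dotC y x) /=; ring. Qed.

Lemma dot_sqrBC x y : ip (x - y) (x - y) = ip (y - x) (y - x).
Proof. by rewrite !dot_sqrB (dotC x y); ring. Qed.

Lemma dot_sqrZ (a : R) x : ip (a *: x) (a *: x) = a ^+ 2 * ip x x.
Proof. by rewrite !dotE /=; ring. Qed.

Lemma dot_sqrD_le x y : ip (x + y) (x + y) <= 2 * ip x x + 2 * ip y y.
Proof. by have := dot_ge0 (x - y); rewrite dot_sqrB dot_sqrD; lra. Qed.

Lemma dot_Young (s : R) x y : 0 < s ->
  2 * ip x y <= s * ip x x + s^-1 * ip y y.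
Proof.
move=> s0; have := dot_ge0 (s *: x - y).
rewrite dot_sqrB dot_sqrZ !dotE => h.
have si0 : 0 <= s^-1 by rewrite invr_ge0 ltW.
have := mulr_ge0 si0 h; have ss : s^-1 * s = 1 by rewrite mulVf// gt_eqF.
have -> : s^-1 * (s ^+ 2 * ip x x - 2 * (s * ip x y) + ip y y) =
    (s^-1 * s) * (s * ip x x) - 2 * ((s^-1 * s) * ip x y) + s^-1 * ip y y.
  by ring.
by rewrite ss; lra.
Qed.

Lemma dot_CauchySchwarz x y : (ip x y) ^+ 2 <= ip x x * ip y y.
Proof.
have [->|y0] := eqVneq y 0; first by rewrite !dot0r expr0n /= mulr0.
have yy : 0 < ip y y by rewrite neq0_dnorm_gt0.
have := dot_ge0 (ip y y *: x - ip x y *: y).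
rewrite dot_sqrB !dot_sqrZ !dotE /= => h.
rewrite -(ler_pM2l yy); nra.
Qed.

End InnerProduct.

(** * Minimization in a Hilbert space *)

(** First-order optimality at the left endpoint of a segment. *)
Lemma linear_part_ge0 {R : realType} (D Q : R) : 0 <= Q ->
  (forall s, 0 < s -> s <= 1 -> 0 <= s * D + s ^+ 2 * Q) -> 0 <= D.
Proof.
move=> Q0 DQ; rewrite leNgt; apply/negP => D0.
have P0 : 0 < 2 * Q - D + 1 by lra.
pose s := - D / (2 * Q - D + 1).
have sE : s * (2 * Q - D + 1) = - D by rewrite divfK// gt_eqF.
have s0 : 0 < s by rewrite divr_gt0// oppr_gt0.
have s1 : s <= 1 by rewrite ler_pdivrMr//; lra.
have := DQ s s0 s1; rewrite expr2 -mulrA -mulrDr pmulr_rge0//.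
nra.
Qed.

Section Hilbert.
Context {R : realType} {X : completeNormedModType R} (ip : {dot X for idfun}).
Hypothesis ip_norm : forall x : X, `|x| = Num.sqrt (ip x x).

Lemma sqr_norm_dot (x : X) : `|x| ^+ 2 = ip x x.
Proof. by rewrite ip_norm sqr_sqrtr// dot_ge0. Qed.

Lemma cvg_dot_self (u : nat -> X) (c : X) :
  u n @[n --> \oo] --> c -> ip (u n) (u n) @[n --> \oo] --> ip c c.
Proof.
move=> uc; rewrite -sqr_norm_dot.
under eq_fun do rewrite -sqr_norm_dot expr2.
by rewrite expr2; apply: cvgM; apply: cvg_norm.
Qed.

Lemma cvg_dot (u : nat -> X) (c y : X) :
  u n @[n --> \oo] --> c -> ip (u n) y @[n --> \oo] --> ip c y.
Proof.
move=> uc.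
have E (a : X) : ip a y = 2^-1 * (ip (a + y) (a + y) - ip a a - ip y y).
  by rewrite dot_sqrD; field.
rewrite E; under eq_fun do rewrite E.
apply: cvgM; first exact: cvg_cst.
apply: cvgB; last exact: cvg_cst.
apply: cvgB; last exact: cvg_dot_self.
by apply: (@cvg_dot_self (fun n => u n + y)); apply: cvgD => //; exact: cvg_cst.
Qed.

Lemma cvg_of_sqr_dist (u : nat -> X) (C : R) :
  (forall n k, ip (u n - u k) (u n - u k) <= C * (n.+1%:R^-1 + k.+1%:R^-1)) ->
  cvgn u.
Proof.
move=> uC; apply/cauchy_cvgP/cauchy_exP => e e0.
have C1 : 0 < `|C| + 1 by rewrite ltr_wpDl.
have d0 : 0 < e ^+ 2 / (2 * (`|C| + 1)) by rewrite divr_gt0 ?exprn_gt0 ?mulr_gt0.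
near \oo => N; exists (u N).
suff : \forall n \near \oo, ball (u N) e (u n) by [].
near=> n; rewrite /= -ball_normE /=.
rewrite -(ltr_pXn2r (n := 2))// ?nnegrE ?(ltW e0)// sqr_norm_dot.
apply: le_lt_trans (uC _ _) _.
have iN : N.+1%:R^-1 < e ^+ 2 / (2 * (`|C| + 1)).
  by near: N; exact: (near_infty_natSinv_lt (PosNum d0)).
have i_n : n.+1%:R^-1 < e ^+ 2 / (2 * (`|C| + 1)).
  by near: n; exact: (near_infty_natSinv_lt (PosNum d0)).
apply: (@le_lt_trans _ _ ((`|C| + 1) * (N.+1%:R^-1 + n.+1%:R^-1))).
  apply: ler_wpM2r; first by rewrite addr_ge0.
  by rewrite (le_trans (ler_norm _))// lerDl.
rewrite mulrC -ltr_pdivlMr//.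
apply: lt_le_trans (ltrD iN i_n) _.
rewrite le_eqVlt; apply/orP; left; apply/eqP.
by field; rewrite gt_eqF// ltr_wpDl.
Unshelve. all: by end_near. Qed.

(** A strongly convex objective attains its infimum on a closed convex set:
    minimizing sequences are Cauchy by the parallelogram law. The set lives in
    [X * X * R] and is curried; only midpoint convexity is needed. *)
Lemma quadratic_minimizer (E : X -> X -> R -> Prop) (b : R)
    (obj := fun x u t => t + 2^-1 * (ip x x + ip u u)) :
  (exists x u t, E x u t) ->
  (forall x u t y v s, E x u t -> E y v s ->
     E (2^-1 *: (x + y)) (2^-1 *: (u + v)) (2^-1 * (t + s))) ->
  (forall (xs us : nat -> X) (ts : nat -> R) x u t,
     (forall n, E (xs n) (us n) (ts n)) ->
     xs n @[n --> \oo] --> x -> us n @[n --> \oo] --> u ->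
     ts n @[n --> \oo] --> t -> E x u t) ->
  (forall x u t, E x u t -> b <= obj x u t) ->
  exists x u t, E x u t /\
    forall y v s, E y v s -> obj x u t <= obj y v s.
Proof.
move=> [x0 [u0 [t0 E0]]] Emid Ecl Eb.
pose S : set R := [set r | exists x u t, E x u t /\ r = obj x u t].
have S_inf : has_inf S.
  split; first by exists (obj x0 u0 t0), x0, u0, t0.
  by exists b => _ [x [u [t [Et ->]]]]; exact: Eb.
have S_lb y v s : E y v s -> inf S <= obj y v s.
  by move=> Ey; apply: (ge_inf S_inf.2); exists y, v, s.
have /choice[p pP] : forall n : nat, exists p : X * X * R,
    E p.1.1 p.1.2 p.2 /\ obj p.1.1 p.1.2 p.2 < inf S + n.+1%:R^-1.
  move=> n; have n0 : 0 < n.+1%:R^-1 :> R by rewrite invr_gt0.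
  have [r [x [u [t [Et ->]]]] rlt] := inf_adherent n0 S_inf.
  by exists (x, u, t).
pose xs n := (p n).1.1; pose us n := (p n).1.2; pose ts n := (p n).2.
have close n k : ip (xs n - xs k) (xs n - xs k) + ip (us n - us k) (us n - us k)
    <= 4 * (n.+1%:R^-1 + k.+1%:R^-1).
  have [En on] := pP n; have [Ek ok] := pP k.
  have := S_lb _ _ _ (Emid _ _ _ _ _ _ En Ek).
  move: on ok; rewrite /obj -!/(xs _) -!/(us _) -!/(ts _) !dot_sqrB !dot_sqrZ.
  rewrite !dot_sqrD; move: (n.+1%:R^-1) (k.+1%:R^-1) => i j; lra.
have xs_cvg : cvgn xs.
  apply: (@cvg_of_sqr_dist _ 4) => n k; apply: le_trans (close n k).
  by rewrite lerDl dot_ge0.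
have us_cvg : cvgn us.
  apply: (@cvg_of_sqr_dist _ 4) => n k; apply: le_trans (close n k).
  by rewrite lerDr dot_ge0.
pose q n := 2^-1 * (ip (xs n) (xs n) + ip (us n) (us n)).
have q_cvg : q n @[n --> \oo] -->
    2^-1 * (ip (limn xs) (limn xs) + ip (limn us) (limn us)).
  by apply: cvgM; [exact: cvg_cst|apply: cvgD; apply: cvg_dot_self].
have o_cvg : ts n + q n @[n --> \oo] --> inf S.
  apply: (@squeeze_cvgr _ _ _ _ (fun=> inf S) (fun n => inf S + n.+1%:R^-1)).
  - near=> n; have [En on] := pP n; rewrite S_lb//=; exact: ltW.
  - exact: cvg_cst.
  - rewrite -[X in _ --> X]addr0; apply: cvgD; first exact: cvg_cst.
    by have := @cvg_harmonic R; apply.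
have t_cvg := cvgB o_cvg q_cvg.
set t := (X in _ --> X) in t_cvg.
exists (limn xs), (limn us), t; split.
  apply: (Ecl xs us ts) => //; first by move=> n; exact: (pP n).1.
  have -> : ts = (fun n => ts n + q n) \- q by apply/funext => n /=; ring.
  exact: t_cvg.
by move=> y v s /S_lb; apply: le_trans; rewrite /obj /t; lra.
Unshelve. all: by end_near. Qed.

End Hilbert.

(** * Limits along ultrafilters *)

Lemma cvg_le_cst {R : realType} {T : Type} {F : set_system T}
    {FF : ProperFilter F} (f : T -> R) (l b : R) :
  f x @[x --> F] --> l -> (\forall x \near F, f x <= b) -> l <= b.
Proof.
move=> fl fb; rewrite leNgt; apply/negP => bl.
have [x [fx]] := filter_ex (filterI fb (cvgr_gt _ fl _ bl)).
by rewrite ltNge fx.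
Qed.

Lemma cvg_real_eq {R : realType} {T : Type} {F : set_system T}
    {FF : ProperFilter F} (f : T -> R) (l l' : R) :
  f x @[x --> F] --> l -> f x @[x --> F] --> l' -> l = l'.
Proof. by move=> fl fl'; apply: (@cvg_unique _ _ (f x @[x --> F])). Qed.

Lemma bounded_ultra_cvg {R : realType} {T : Type} {F : set_system T}
    {FU : UltraFilter F} (f : T -> R) (M : R) :
  (\forall x \near F, `|f x| <= M) -> exists l : R, f x @[x --> F] --> l.
Proof.
move=> fM.
have fMM : (f x @[x --> F]) `[- M, M]%classic.
  by apply: filterS fM => x /=; rewrite ler_norml in_itv.
have [p [_ pF]] := @segment_compact R (- M) M (f x @[x --> F]) _ fMM.
exists p => U Up.
have [//|FU'] := in_ultra_setVsetC (f @^-1` U) FU.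
by have [y [NUy /NUy]] := pF (~` U) U FU' Up.
Qed.

(** A property that does not hold eventually fails along some ultrafilter. *)
Lemma ultra_not_near {T : Type} (G : set_system T) {GG : ProperFilter G}
    (P : set T) :
  ~ G P -> exists F : set_system T, [/\ UltraFilter F, G `<=` F & F (~` P)].
Proof.
move=> nP.
have Wp : ProperFilter (within (~` P) G).
  apply: Build_ProperFilter_ex => Q; rewrite /within /= => GQ.
  apply: contrapT => nQ; apply: nP; apply: filterS GQ => x Qx.
  by apply: contrapT => Px; apply: nQ; exists x; exact: Qx.
have [F [FU sF]] := ultraFilterLemma Wp.
exists F; split => //; last by apply: sF; exact: withinT.
by move=> Q GQ; apply: sF; rewrite /within /=; apply: filterS GQ => x Qx _.
Qed.

Lemma cvg_of_ultra {T : Type} {U : topologicalType} (G : set_system T)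
    {GG : ProperFilter G} (f : T -> U) (l : U) :
  (forall F, UltraFilter F -> G `<=` F -> f x @[x --> F] --> l) ->
  f x @[x --> G] --> l.
Proof.
move=> Fl A Al; apply: contrapT => /(@ultra_not_near _ G _ (f @^-1` A)).
move=> [F [FU GF nA]].
have FA : F (f @^-1` A) := Fl F FU GF A Al.
by have [x []] := filter_ex (filterI FA nA).
Qed.

(** Bounded sequences of [V] have weak limits along every ultrafilter; this
    form of weak compactness avoids extracting subsequences. *)
Definition weakly_ultracompact {R : realType} {V : lmodType R}
    (ip : V -> V -> R) : Prop :=
  forall (F : set_system nat) (u : nat -> V) (M : R), UltraFilter F ->
    (\forall n \near F, ip (u n) (u n) <= M) ->
    exists c, forall y, ip (u n) y @[n --> F] --> ip c y.

(** * The Riesz representation theorem and weak compactness *)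

Section Riesz.
Context {R : realType} {X : completeNormedModType R} (ip : {dot X for idfun}).
Hypothesis ip_norm : forall x : X, `|x| = Num.sqrt (ip x x).

Lemma dot_norm_le (x y : X) : `|ip x y| <= `|x| * `|y|.
Proof.
rewrite -(ler_pXn2r (n := 2))// ?nnegrE ?mulr_ge0//.
rewrite exprMn !(sqr_norm_dot ip ip_norm) real_normK ?num_real//.
exact: dot_CauchySchwarz.
Qed.

(** The representing vector minimizes [2^-1 * ip x x - L x]. *)
Lemma Riesz_representation (L : X -> R) (K : R) :
  (forall a x y, L (a *: x + y) = a * L x + L y) ->
  (forall x, `|L x| <= K * `|x|) -> exists c, forall y, L y = ip c y.
Proof.
move=> Llin LK.
have LD x y : L (x + y) = L x + L y by rewrite -[x]scale1r Llin mul1r scale1r.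
have L0 : L 0 = 0 by apply: (addrI (L 0)); rewrite -LD !addr0.
have LZ a x : L (a *: x) = a * L x by rewrite -[a *: x]addr0 Llin L0 addr0.
have LN x : L (- x) = - L x by rewrite -[- x]scaleN1r LZ mulN1r.
pose E (x u : X) (t : R) := u = 0 /\ t = - L x.
have [||||c [u [t [[-> ->] cmin]]]] :=
    @quadratic_minimizer _ _ ip ip_norm E (- (2^-1 * K ^+ 2)).
- by exists 0, 0, 0; split => //; rewrite L0 oppr0.
- move=> x u t y v s [-> ->] [-> ->]; split; first by rewrite addr0 scaler0.
  by rewrite LZ LD; ring.
- move=> xs us ts x u t Es xsx usu tst; split.
    apply: (@cvg_unique _ _ (us n @[n --> \oo])) => //.
    have -> : us = (fun=> 0) by apply/funext => n; exact: (Es n).1.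
    exact: cvg_cst.
  apply: (@cvg_unique _ _ (ts n @[n --> \oo])) => //.
  have -> : ts = (fun n => - L (xs n)) by apply/funext => n; exact: (Es n).2.
  apply: cvgN; apply/subr_cvg0/norm_cvg0P.
  apply: (@squeeze_cvgr _ _ _ _ (fun=> 0) (fun n => K * `|xs n - x|)).
  + apply: nearW => n; rewrite normr_ge0 /=.
    suff -> : L (xs n) - L x = L (xs n - x) by exact: LK.
    by rewrite LD LN.
  + exact: cvg_cst.
  + rewrite -[X in _ --> X](mulr0 K); apply: cvgM; first exact: cvg_cst.
    by apply/norm_cvg0P/subr_cvg0.
- move=> x u t [-> ->]; rewrite dot0l addr0 -(sqr_norm_dot ip ip_norm).
  have := le_trans (ler_norm _) (LK x).
  by have := sqr_ge0 (K - `|x|); nra.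
exists c => y; apply/eqP; rewrite -subr_eq0; apply/eqP.
set r := L y - ip c y.
have q s : 0 <= - s * r + 2^-1 * s ^+ 2 * ip y y.
  have /cmin : E (c + s *: y) 0 (- L (c + s *: y)) by [].
  rewrite !dot0l !addr0 LD LZ dot_sqrD dot_sqrZ !dotE /r; lra.
have Q0 : 0 <= 2^-1 * ip y y by rewrite mulr_ge0 ?dot_ge0.
apply/eqP; rewrite eq_le -oppr_ge0; apply/andP; split.
  by apply: linear_part_ge0 Q0 _ => s _ _; have := q s; lra.
by apply: linear_part_ge0 Q0 _ => s _ _; have := q (- s); lra.
Qed.

(** The weak limit along an ultrafilter represents the functional that sends
    [y] to the limit of [ip (u n) y]. *)
Lemma hilbert_weakly_ultracompact : weakly_ultracompact ip.
Proof.
move=> F u M FU uM.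
have uM' : \forall n \near F, `|u n| <= Num.sqrt M.
  by apply: filterS uM => n uM; rewrite ip_norm ler_wsqrtr.
have bnd y : \forall n \near F, `|ip (u n) y| <= Num.sqrt M * `|y|.
  apply: filterS uM' => n h; apply: le_trans (dot_norm_le _ _) _.
  exact: ler_wpM2r.
have /choice[L LP] : forall y, exists l : R, ip (u n) y @[n --> F] --> l.
  by move=> y; exact: bounded_ultra_cvg (bnd y).
have [||c cP] := Riesz_representation L (Num.sqrt M).
- move=> a x y; apply: cvg_real_eq (LP (a *: x + y)) _.
  have -> : (fun n => ip (u n) (a *: x + y)) =
      (fun n => a * ip (u n) x + ip (u n) y).
    by apply/funext => n; rewrite dotDr dotZr.
  apply: cvgD; last exact: LP.
  by apply: cvgM; [exact: cvg_cst|exact: LP].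
- by move=> y; apply: (cvg_le_cst _ _ _ (cvg_norm (LP y)) (bnd y)).
by exists c => y; rewrite -cP.
Qed.

End Riesz.

(** * Maximally monotone operators and resolvents *)

Section MaximallyMonotone.
Context {R : realType} {X : lmodType R} (ip : {dot X for idfun}).
Implicit Types B : X -> set X.

(** Maximality, pointwise: every point monotonically related to the graph lies
    on it. *)
Lemma maximally_monotoneP B : maximally_monotone ip B <->
  Defs.monotone ip B /\
  forall x u, (forall y v, B y v -> 0 <= ip (x - y) (u - v)) -> B x u.
Proof.
split=> -[monB maxB]; split=> //.
  move=> x u xu.
  pose C z := [set w | B z w \/ z = x /\ w = u].
  have <- : C x = B x.
    apply: maxB => [|z w Bw]; last by left.
    move=> y z v w [By|[-> ->]] [Bz|[-> ->]].
    - exact: monB.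
    - by have := xu _ _ By; rewrite !dotE; lra.
    - exact: xu.
    - by rewrite subrr dot0l.
  by right.
move=> C monC BC x; apply/seteqP; split; last exact: BC.
by move=> u Cu; apply: maxB => y v /BC; exact: monC.
Qed.

Lemma maximally_monotone_scale B c : 0 < c ->
  maximally_monotone ip B -> maximally_monotone ip (op_scale c B).
Proof.
move=> c0 /maximally_monotoneP[monB maxB]; apply/maximally_monotoneP; split.
  move=> x y _ _ [u Bu <-] [v Bv <-].
  by rewrite -scalerBr dotZr mulr_ge0 ?(ltW c0)//; exact: monB.
move=> x u xu; exists (c^-1 *: u); last by rewrite scalerA divff ?gt_eqF// scale1r.
apply: maxB => y v Bv; rewrite -(pmulr_rge0 _ c0) -dotZr.
rewrite scalerBr scalerA divff ?gt_eqF// scale1r.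
by apply: xu; exists v.
Qed.

Lemma maximally_monotone_shift B z : maximally_monotone ip B ->
  maximally_monotone ip (fun x => [set u | B x (u + z)]).
Proof.
move=> /maximally_monotoneP[monB maxB]; apply/maximally_monotoneP; split.
  by move=> x y u v /= Bu Bv; have := monB _ _ _ _ Bu Bv; rewrite !dotE; lra.
move=> x u xu /=; apply: maxB => y v Bv.
have : 0 <= ip (x - y) (u - (v - z)) by apply: xu; rewrite /= subrK.
by rewrite !dotE; lra.
Qed.

Lemma op_scaleP (c : R) B x u : c != 0 -> op_scale c B x u <-> B x (c^-1 *: u).
Proof.
move=> c0; split=> [[v Bv <-]|Bu]; first by rewrite scalerA mulVf// scale1r.
by exists (c^-1 *: u) => //; rewrite scalerA divff// scale1r.
Qed.

End MaximallyMonotone.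

Section Minty.
Context {R : realType} {X : completeNormedModType R} (ip : {dot X for idfun}).
Hypothesis ip_norm : forall x : X, `|x| = Num.sqrt (ip x x).

(** The epigraph of the Fitzpatrick function of [B]. *)
Let fitzpatrick_epi (B : X -> set X) (x u : X) (t : R) : Prop :=
  forall y v, B y v -> ip x v + ip y u - ip y v <= t.

(** The Fitzpatrick function dominates the duality pairing, so its sum with
    half the squared norm has a minimizer [(x, u)]; optimality there forces
    [u = - x] and [B x u]. *)
Let Minty0 (B : X -> set X) : maximally_monotone ip B -> exists x, B x (- x).
Proof.
move=> /maximally_monotoneP[monB maxB].
have epi_graph y v : B y v -> fitzpatrick_epi B y v (ip y v).
  move=> Bv y' v' Bv'; have := monB _ _ _ _ Bv Bv'.
  by rewrite !dotE; lra.
have epi_ge x u t : fitzpatrick_epi B x u t -> ip x u <= t.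
  move=> Et; rewrite leNgt; apply/negP => tlt.
  have /Et : B x u by apply: maxB => y v /Et; rewrite !dotE; lra.
  by lra.
have [||||x0 [u0 [t0 [E0 min0]]]] :=
    @quadratic_minimizer _ _ ip ip_norm (fitzpatrick_epi B) 0.
- suff [y [v Bv]] : exists y v, B y v by exists y, v, (ip y v); exact: epi_graph.
  apply: contrapT => nB; apply: (nB); exists 0, 0; apply: maxB => y v Bv.
  by case: nB; exists y, v.
- move=> x u t y v s Et Es y' v' Bv'.
  by have := Et _ _ Bv'; have := Es _ _ Bv'; rewrite !dotE; lra.
- move=> xs us ts x u t Es xsx usu tst y v Bv.
  have c1 := cvg_dot ip ip_norm _ _ v xsx.
  have c2 := cvg_dot ip ip_norm _ _ y usu.
  have c3 : ip (xs n) v + ip (us n) y - ts n @[n --> \oo] -->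
      ip x v + ip u y - t by exact: cvgB (cvgD c1 c2) tst.
  rewrite lerBlDr -lerBlDl (dotC ip y u) (dotC ip y v).
  apply: (cvg_le_cst _ _ _ c3); apply: nearW => n /=.
  by have := Es n _ _ Bv; rewrite !(dotC ip y); lra.
- move=> x u t /epi_ge xu.
  by have := dot_ge0 ip (x + u); rewrite dot_sqrD; lra.
have opt y v : B y v ->
    0 <= (ip y v - t0) + (ip x0 (y - x0) + ip u0 (v - u0)).
  move=> Bv; pose Q := 2^-1 * (ip (y - x0) (y - x0) + ip (v - u0) (v - u0)).
  apply: (linear_part_ge0 _ Q); first by rewrite mulr_ge0// addr_ge0 ?dot_ge0.
  move=> s s0 s1.
  have : fitzpatrick_epi B (x0 + s *: (y - x0)) (u0 + s *: (v - u0))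
      (t0 + s * (ip y v - t0)).
    move=> y' v' Bv'; have h0 := E0 _ _ Bv'; have h1 := epi_graph _ _ Bv _ _ Bv'.
    rewrite !dotE; nra.
  by move=> /min0; rewrite !dot_sqrD !dot_sqrZ !dotZr /Q; lra.
have x0u0 := epi_ge _ _ _ E0.
have key y v : B y v -> ip (x0 + u0) (x0 + u0) <= ip (- u0 - y) (- x0 - v).
  move=> /opt; rewrite dot_sqrD !dotE (dotC ip u0 x0) (dotC ip y x0); lra.
have B0 : B (- u0) (- x0).
  by apply: maxB => y v /key; apply: le_trans; exact: dot_ge0.
have := key _ _ B0; rewrite subrr dot0l => /dot_eq0 /eqP.
rewrite addrC addr_eq0 => /eqP u0E.
by exists x0; move: B0; rewrite u0E opprK.
Qed.

(** Minty's theorem: [Id + B] is surjective. *)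
Lemma Minty (B : X -> set X) z :
  maximally_monotone ip B -> exists x, B x (z - x).
Proof.
move=> /(maximally_monotone_shift _ _ z)/Minty0[x]; rewrite /= addrC.
by exists x.
Qed.

Lemma resolventP (B : X -> set X) z x : maximally_monotone ip B ->
  resolvent B z = x <-> B x (z - x).
Proof.
move=> maxB.
have invP y : op_inv (op_add (@op_id X) B) z y <-> B y (z - y).
  split=> [[_ -> [v Bv <-]]|By]; first by rewrite addrC addKr.
  by exists y => //; exists (z - y) => //; rewrite addrC subrK.
have [x' Bx'] := Minty _ z maxB.
have uniq y : B y (z - y) -> y = x'.
  move=> By; have := maxB.1 _ _ _ _ By Bx'.
  have -> : z - y - (z - x') = - (y - x') by rewrite opprB opprB addrC subrKA.
  rewrite dotNr oppr_ge0 => /dot_eq0 /eqP; rewrite subr_eq0.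
  by move=> /eqP.
rewrite /resolvent; case: xgetP => [y _ /invP By|/(_ x')/invP//].
by rewrite (uniq _ By); split=> [<-//|/uniq].
Qed.

Lemma resolvent_firmly_nonexpansive (B : X -> set X) x y
    (J := resolvent B) : maximally_monotone ip B ->
  ip (J x - J y) (J x - J y) <= ip (J x - J y) (x - y).
Proof.
move=> maxB.
have /(resolventP B _ _ maxB) Bx := erefl (J x).
have /(resolventP B _ _ maxB) By := erefl (J y).
have := maxB.1 _ _ _ _ Bx By.
by rewrite !dotE; lra.
Qed.

End Minty.

(** * Iterating an averaged operator *)

Lemma telescoping_cvg0 {R : realType} (f b : nat -> R) (k : R) : 0 < k ->
  (forall n, 0 <= f n) -> (forall n, 0 <= b n) ->
  (forall n, f n.+1 + k * b n <= f n) ->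
  (exists l : R, f n @[n --> \oo] --> l) /\ b n @[n --> \oo] --> (0 : R).
Proof.
move=> k0 f0 b0 fb.
have fni : nonincreasing_seq f.
  apply/nonincreasing_seqP => n; apply: le_trans (fb n).
  by rewrite lerDl mulr_ge0// ltW.
have fl : has_lbound (range f) by exists 0 => _ [n _ <-].
have fcvg := nonincreasing_cvgn fni fl.
set l := inf _ in fcvg.
have fScvg : f n.+1 @[n --> \oo] --> l.
  by rewrite (cvg_shiftS f (nbhs l)).
split; first by exists l.
apply: (@squeeze_cvgr _ _ _ _ (fun=> 0) (fun n => k^-1 * (f n - f n.+1))).
- apply: nearW => n; rewrite b0 /= -(ler_pM2l k0) mulrA divff ?gt_eqF// mul1r.
  by have := fb n; lra.
- exact: cvg_cst.
- have -> : 0 = k^-1 * (l - l) by rewrite subrr mulr0.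
  by apply: cvgM; [exact: cvg_cst|exact: cvgB].
Qed.

(** [T] is averaged: with [k = (1 - alpha) / alpha] this says that [T] is
    [alpha]-averaged, that is, [(1 - alpha) Id + alpha N] with [N]
    nonexpansive. *)
Definition averaged {R : realType} {V : lmodType R} (ip : V -> V -> R) (k : R)
    (T : V -> V) : Prop :=
  forall x y, ip (T x - T y) (T x - T y)
    + k * ip ((x - T x) - (y - T y)) ((x - T x) - (y - T y))
    <= ip (x - y) (x - y).

Section Averaged.
Context {R : realType} {V : lmodType R} (ip : {dot V for idfun}).
Variables (T : V -> V) (k : R).
Hypotheses (k_gt0 : 0 < k) (T_avg : averaged ip k T).

Lemma averaged_nonexpansive x y :
  ip (T x - T y) (T x - T y) <= ip (x - y) (x - y).
Proof.
by apply: le_trans (T_avg x y); rewrite lerDl mulr_ge0 ?dot_ge0// ltW.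
Qed.

(** Demiclosedness of [Id - T] at [0]: the weak limit [c] of an approximate
    fixed point sequence is fixed, as [T c] is asymptotically at least as close
    to the sequence as [c] is, while [c] is the only closest point. *)
Lemma averaged_demiclosed (F : set_system nat) {FF : ProperFilter F}
    (u : nat -> V) (c : V) (M : R) :
  (\forall n \near F, ip (u n) (u n) <= M) ->
  (forall y, ip (u n) y @[n --> F] --> ip c y) ->
  ip (u n - T (u n)) (u n - T (u n)) @[n --> F] --> (0 : R) ->
  c = T c.
Proof.
move=> uM uc e0.
apply/eqP; rewrite -subr_eq0; apply/eqP/(dot_eq0 ip).
set w := c - T c; rewrite leNgt; apply/negP => W0; set W := ip w w in W0.
pose K := 2 * M + 2 * ip (w - c) (w - c).
have [n0 hn0] := filter_ex uM.
have M0 := le_trans (dot_ge0 ip _) hn0.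
have K0 : 0 <= K by rewrite addr_ge0 ?mulr_ge0 ?dot_ge0.
(* the weight in Young's inequality: it bounds the term in [u n] by [W / 4] *)
pose s := W / (4 * (K + 1)).
have K1 : 0 < 4 * (K + 1) by lra.
have s0 : 0 < s by rewrite divr_gt0.
have sE : s * (4 * (K + 1)) = W by rewrite divfK ?gt_eqF.
have sK : s * K <= 4^-1 * W by nra.
have si0 : 0 < s^-1 by rewrite invr_gt0.
have W4 : 0 < s * (4^-1 * W) by rewrite mulr_gt0//; lra.
have near1 : \forall n \near F, ip c w - 8^-1 * W < ip (u n) w.
  by apply: cvgr_gt (uc w) _ _; lra.
have near2 : \forall n \near F,
    ip (u n - T (u n)) (u n - T (u n)) < s * (4^-1 * W) by exact: cvgr_lt e0 _ W4.
have [n [[un u1] u2]] := filter_ex (filterI (filterI uM near1) near2).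
set e := u n - T (u n) in u2.
have := averaged_nonexpansive (u n) c.
have -> : T (u n) = u n - e by rewrite subKr.
have -> : T c = c - w by rewrite subKr.
clearbody e w.
have se : s^-1 * ip e e <= 4^-1 * W.
  by rewrite -(ler_pM2l s0) mulrA divff ?gt_eqF// mul1r; exact: ltW.
have sD : s * ip (u n + (w - c)) (u n + (w - c)) <= s * K.
  apply: ler_wpM2l; first exact: ltW.
  by have := dot_sqrD_le ip (u n) (w - c); rewrite /K; lra.
have := dot_ge0 ip e.
have : 2 * ip (u n + (w - c)) e <= 2^-1 * W.
  by have := dot_Young ip s (u n + (w - c)) e s0; lra.
rewrite !dotE (dotC ip e (u n)) (dotC ip c (u n)) (dotC ip w (u n)) (dotC ip e c)
  (dotC ip w c) (dotC ip e w) -/W.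
by move: u1; lra.
Qed.

Variable x : nat -> V.
Hypothesis x_orbit : forall n, x n.+1 = T (x n).

Lemma averaged_Fejer c : c = T c ->
  (exists l : R, ip (x n - c) (x n - c) @[n --> \oo] --> l) /\
  ip (x n - x n.+1) (x n - x n.+1) @[n --> \oo] --> (0 : R).
Proof.
move=> cT.
apply: (telescoping_cvg0 (fun n => ip (x n - c) (x n - c)) _ k) => // n.
- exact: dot_ge0.
- exact: dot_ge0.
by have := T_avg (x n) c; rewrite -cT subrr subr0 -x_orbit.
Qed.

(** Opial's argument: all the weak ultralimits of the orbit are fixed points,
    and two of them agree because the distances to both converge. *)
Theorem averaged_weak_cvg c0 : weakly_ultracompact ip -> c0 = T c0 ->
  exists c, c = T c /\ weak_cvg ip x c.
Proof.
move=> wuc c0T; have [_ d0] := averaged_Fejer _ c0T.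
have x_bnd n : ip (x n) (x n) <= 2 * ip (x 0%N - c0) (x 0%N - c0) + 2 * ip c0 c0.
  have -> : x n = (x n - c0) + c0 by rewrite subrK.
  apply: le_trans (dot_sqrD_le _ _ _) _.
  rewrite lerD2r ler_pM2l//; elim: n => // n; apply: le_trans.
  by rewrite x_orbit [in leLHS]c0T; exact: averaged_nonexpansive.
have lim (F : set_system nat) : UltraFilter F -> \oo `<=` F ->
    exists c, c = T c /\ forall y, ip (x n) y @[n --> F] --> ip c y.
  move=> FU Foo.
  have x_near : \forall n \near F, ip (x n) (x n) <=
      2 * ip (x 0%N - c0) (x 0%N - c0) + 2 * ip c0 c0 by exact: nearW.
  have [c xc] := wuc F x _ FU x_near.
  exists c; split=> //.
  apply: averaged_demiclosed x_near xc _ => A A0.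
  by apply: Foo; under eq_fun do rewrite -x_orbit; exact: d0.
have [F0 [F0U F0oo]] := ultraFilterLemma (eventually_filter).
have [c [cT xc]] := lim F0 F0U F0oo.
exists c; split=> // y; apply: cvg_of_ultra => F FU Foo.
have [d [dT xd]] := lim F FU Foo.
suff -> : c = d by exact: xd.
apply/eqP; rewrite -subr_eq0; apply/eqP/(dot_eq0 ip).
have [[lc lcE] _] := averaged_Fejer _ cT.
have [[ld ldE] _] := averaged_Fejer _ dT.
have cvg_cd : ip (x n) (c - d) @[n --> \oo] -->
    2^-1 * (ld - lc + (ip c c - ip d d)).
  have -> : (fun n => ip (x n) (c - d)) = (fun n => 2^-1 *
      (ip (x n - d) (x n - d) - ip (x n - c) (x n - c) + (ip c c - ip d d))).
    by apply/funext => n; rewrite !dot_sqrB dotDr dotNr; field.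
  apply: cvgM; first exact: cvg_cst.
  by apply: cvgD; [exact: cvgB|exact: cvg_cst].
have c_lim := cvg_real_eq _ _ _ (xc (c - d)) (fun A hA => F0oo _ (cvg_cd A hA)).
have d_lim := cvg_real_eq _ _ _ (xd (c - d)) (fun A hA => Foo _ (cvg_cd A hA)).
by rewrite dotDl dotNl c_lim d_lim subrr.
Qed.

(** If the steps do not vanish, the orbit escapes linearly: consecutive steps
    become parallel, so [x (n + j) - x n] is close to [j] times a step of
    length bounded below, while its length does not increase with [n]. *)
Lemma averaged_escape (delta : R) : 0 < delta ->
  (forall n, delta <= ip (x n - x n.+1) (x n - x n.+1)) ->
  forall j, 4^-1 * j%:R ^+ 2 * delta <= ip (x 0%N - x j) (x 0%N - x j).
Proof.
move=> delta0 d_ge j.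
pose d n := x n - x n.+1.
have dd0 : ip (d n - d n.+1) (d n - d n.+1) @[n --> \oo] --> (0 : R).
  apply: (telescoping_cvg0 (fun n => ip (d n) (d n)) _ k _ _ _ _).2 => // n.
  - exact: dot_ge0.
  - exact: dot_ge0.
  have := T_avg (x n) (x n.+1); rewrite -!x_orbit.
  by rewrite -!/(d _).
have sumD0 (f g : nat -> V) : ip (f n) (f n) @[n --> \oo] --> (0 : R) ->
    ip (g n) (g n) @[n --> \oo] --> (0 : R) ->
    ip (f n + g n) (f n + g n) @[n --> \oo] --> (0 : R).
  move=> f0 g0.
  apply: (@squeeze_cvgr _ _ _ _ (fun=> 0)
    (fun n => 2 * ip (f n) (f n) + 2 * ip (g n) (g n))).
  - by apply: nearW => n; rewrite dot_ge0 dot_sqrD_le.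
  - exact: cvg_cst.
  - have -> : 0 = 2 * 0 + 2 * 0 :> R by rewrite mulr0 addr0.
    by apply: cvgD; apply: cvgM => //; exact: cvg_cst.
(* steps a fixed number of iterations apart become equal *)
have dj0 i : ip (d n - d (n + i)%N) (d n - d (n + i)%N) @[n --> \oo] --> (0 : R).
  elim: i => [|i IH].
    under eq_fun do rewrite addn0 subrr dot0l.
    exact: cvg_cst.
  have shift : ip (d (n + i)%N - d (n + i).+1) (d (n + i)%N - d (n + i).+1)
      @[n --> \oo] --> (0 : R).
    rewrite (cvg_shiftn i (fun n => ip (d n - d n.+1) (d n - d n.+1)) (nbhs 0)).
    exact: dd0.
  have := sumD0 _ _ IH shift.
  by under eq_fun do rewrite addrA subrK -addnS.
have ej0 i : ip ((x n - x (n + i)%N) - i%:R *: d n)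
    ((x n - x (n + i)%N) - i%:R *: d n) @[n --> \oo] --> (0 : R).
  elim: i => [|i IH].
    under eq_fun do rewrite addn0 subrr scale0r subr0 dot0l.
    exact: cvg_cst.
  have dj0' : ip (d (n + i)%N - d n) (d (n + i)%N - d n) @[n --> \oo] -->
      (0 : R) by under eq_fun do rewrite dot_sqrBC; exact: dj0.
  have := sumD0 _ _ IH dj0'.
  under eq_fun => n.
    have -> : x n - x (n + i)%N - i%:R *: d n + (d (n + i)%N - d n) =
        x n - x (n + i.+1)%N - i.+1%:R *: d n.
      rewrite -natr1 scalerDl scale1r [in RHS]opprD addrACA addnS.
      by congr (_ + _); rewrite /d addrA subrK.
    over.
  by [].
have decr n : ip (x n - x (n + j)%N) (x n - x (n + j)%N) <=
    ip (x 0%N - x j) (x 0%N - x j).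
  elim: n => // n; apply: le_trans.
  by rewrite addSn !x_orbit; exact: averaged_nonexpansive.
case: j => [|j] in decr *.
  by rewrite expr0n mulr0 mul0r dot_ge0.
have small : 0 < 4^-1 * j.+1%:R ^+ 2 * delta.
  by rewrite !mulr_gt0// ?exprn_gt0 ?ltr0n// invr_gt0.
have [n en] := filter_ex (cvgr_lt _ (ej0 j.+1) _ small).
apply: le_trans (decr n); set p := x n - _ in en *.
have := dot_sqrD_le ip p (j.+1%:R *: d n - p).
rewrite addrC subrK dot_sqrZ [X in _ <= _ + 2 * X]dot_sqrBC.
have : j.+1%:R ^+ 2 * delta <= j.+1%:R ^+ 2 * ip (d n) (d n).
  by apply: ler_wpM2l; [exact: sqr_ge0|exact: d_ge].
move: en; lra.
Qed.

(** Without fixed points the orbit leaves every ball for good. *)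
Theorem averaged_norm_cvgy : weakly_ultracompact ip ->
  (forall c, c <> T c) -> Num.sqrt (ip (x n) (x n)) @[n --> \oo] --> +oo.
Proof.
move=> wuc noFix.
pose a n := ip (x n - x n.+1) (x n - x n.+1).
have a_ni : nonincreasing_seq a.
  apply/nonincreasing_seqP => n.
  by rewrite /a 2!x_orbit (x_orbit n) averaged_nonexpansive.
have a_lb : has_lbound (range a) by exists 0 => _ [n _ <-]; exact: dot_ge0.
have a_cvg := nonincreasing_cvgn a_ni a_lb.
have a_ge n : inf (range a) <= a n by apply: ge_inf => //; exists n.
have [inf0|infpos] := leP (inf (range a)) 0.
  (* the steps vanish: a bounded part of the orbit yields a fixed point *)
  apply/cvgryPge => A; apply: contrapT => /ultra_not_near[F [FU Foo FA]].
  have bnd : \forall n \near F, ip (x n) (x n) <= A ^+ 2.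
    apply: filterS FA => n /= /negP; rewrite -ltNge => lt.
    rewrite -[leLHS]sqr_sqrtr ?dot_ge0// ler_pXn2r// ?nnegrE ?sqrtr_ge0 ?ltW//.
    exact: le_lt_trans lt.
  have [c xc] := wuc F x _ FU bnd.
  apply: (noFix c); apply: averaged_demiclosed bnd xc _ => B B0.
  apply: Foo; under eq_fun do rewrite -x_orbit.
  apply: a_cvg; suff -> : inf (range a) = 0 by [].
  apply/eqP; rewrite eq_le inf0 lb_le_inf//; first by exists (a 0%N), 0%N.
  by move=> _ [n _ <-]; exact: dot_ge0.
(* the steps have length at least [delta]: linear escape *)
apply/cvgryPge => A.
set delta := inf _ in a_ge infpos.
pose C := 8 * delta^-1 * (A ^+ 2 + ip (x 0%N) (x 0%N)).
near=> n.
have [A0|A0] := leP A 0; first exact: le_trans (sqrtr_ge0 _).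
rewrite -(ler_pXn2r (n := 2))// ?nnegrE ?sqrtr_ge0 ?(ltW A0)// sqr_sqrtr ?dot_ge0//.
have h := averaged_escape _ infpos a_ge n.
have := dot_sqrD_le ip (x 0%N) (- x n).
rewrite dotNl dotNr opprK => h2.
have Cn : C <= n%:R by near: n; exact: nbhs_infty_ger.
have n1 : 1 <= n%:R :> R by rewrite ler1n; near: n; exact: nbhs_infty_ge.
have nn : n%:R <= n%:R ^+ 2 :> R by rewrite expr2 ler_peMl.
have : C * delta <= n%:R ^+ 2 * delta by rewrite ler_pM2r// (le_trans Cn).
have -> : C * delta = 8 * (A ^+ 2 + ip (x 0%N) (x 0%N)).
  by rewrite /C; field; rewrite gt_eqF.
lra.
Unshelve. all: by end_near. Qed.

End Averaged.

(** * The product space *)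

Section Product.
Context {R : realType} {X : lmodType R} (m : nat) (ip : {dot X for idfun}).

(** [prod_ip ip] is again an inner product. *)
Fact prod_ip_bilinear : bilinear_for
  (GRing.Scale.Law.clone _ _ ( *%R) _)
  (GRing.Scale.Law.clone _ _ (@idfun R \; *%R) _) (@prod_ip R X m ip).
Proof.
split=> [y|x] a u v; rewrite /prod_ip /= mulr_sumr -big_split /=;
  by apply: eq_bigr => i _; rewrite !fctE !dotE.
Qed.

HB.instance Definition _ :=
  bilinear_isBilinear.Build R _ _ _ _ _ (@prod_ip R X m ip) prod_ip_bilinear.

Fact prod_ip_symmetric (x y : 'I_m -> X) :
  prod_ip ip x y = (-1) ^+ false * idfun (prod_ip ip y x).
Proof.
by rewrite expr0 mul1r /prod_ip; apply: eq_bigr => i _; rewrite dotC.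
Qed.

HB.instance Definition _ := isHermitianSesquilinear.Build R _ _ _
  (@prod_ip R X m ip) prod_ip_symmetric.

Fact prod_ip_pos (x : 'I_m -> X) : x != 0 -> 0 < prod_ip ip x x.
Proof.
move=> x0; have sum0 : 0 <= prod_ip ip x x by apply: sumr_ge0 => i _; exact: dot_ge0.
rewrite lt_def sum0 andbT; apply: contra x0 => /eqP.
move/psumr_eq0P => /(_ (fun i _ => dot_ge0 ip (x i))) xi0.
by apply/eqP/funext => i; apply/(dot_eq0 ip); rewrite xi0.
Qed.

HB.instance Definition _ := isDotProduct.Build R _ (@prod_ip R X m ip)
  prod_ip_pos.

Lemma prod_weakly_ultracompact :
  weakly_ultracompact ip -> weakly_ultracompact (@prod_ip R X m ip).
Proof.
move=> wuc F u M FU uM.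
have /choice[c cP] : forall i, exists c,
    forall y, ip (u n i) y @[n --> F] --> ip c y.
  move=> i; apply: (wuc F (fun n => u n i) M FU).
  apply: filterS uM => n; apply: le_trans.
  rewrite /prod_ip (bigD1 i)//= lerDl; apply: sumr_ge0 => j _.
  exact: dot_ge0.
exists c => y; rewrite /prod_ip.
by apply: cvg_big => [|i _]; [exact: add_continuous|exact: cP].
Qed.

End Product.

Lemma subrBB_AC {V : zmodType} (x y z t : V) :
  (x - y) - (z - t) = (x - z) - (y - t).
Proof. by rewrite !opprD addrACA. Qed.

(** Firmly nonexpansive after averaged is averaged; the constants are those
    needed for [bold_J] and [bold_R]. *)
Lemma firmly_nonexpansive_comp_averaged {R : realType} {V : lmodType R}
    (ip : {dot V for idfun}) (J Q : V -> V) :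
  (forall x y, ip (J x - J y) (J x - J y) <= ip (J x - J y) (x - y)) ->
  averaged ip 3^-1 Q -> averaged ip 6^-1 (J \o Q).
Proof.
move=> Jfirm Qavg x y /=.
have := Jfirm (Q x) (Q y); have := Qavg x y.
set a := J (Q x) - J (Q y); set r := Q x - Q y.
have -> : x - Q x - (y - Q y) = (x - y) - r by rewrite subrBB_AC.
have -> : x - J (Q x) - (y - J (Q y)) = (x - y - r) + (r - a).
  by rewrite addrA subrK subrBB_AC.
have := dot_sqrD_le ip (x - y - r) (r - a).
have := dot_ge0 ip (r - a).
rewrite [ip (r - a) (r - a)]dot_sqrB (dotC ip r a); lra.
Qed.

(** * The fixed-point problem with uniform weights *)

Section UniformWeights.
Context {R : realType} {X : completeNormedModType R} (ip : {dot X for idfun}).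
Hypothesis ip_norm : forall x : X, `|x| = Num.sqrt (ip x x).
Context {m : nat} (lam : 'I_m -> R) (A : 'I_m -> X -> set X).
Hypotheses (m_ge3 : (3 <= m)%N) (lamE : forall i, lam i = 1 / m%:R).
Hypothesis A_maxmon : forall i, maximally_monotone ip (A i).

Let m3 : 3 <= m%:R :> R.
Proof. by rewrite ler_nat. Qed.

Let muE i : Defs.mu lam i = (m%:R - 1) / m%:R.
Proof. by rewrite /Defs.mu lamE; field; rewrite gt_eqF//; have := m3; lra. Qed.

Let mu_gt0 i : 0 < Defs.mu lam i.
Proof. by rewrite muE divr_gt0//; have := m3; lra. Qed.

Lemma bold_RE (x : 'I_m -> X) i :
  bold_R lam x i = (m%:R - 1)^-1 *: (\sum_j x j - x i).
Proof.
rewrite /bold_R [in RHS](bigD1 i)//= [x i + _]addrC addrK scaler_sumr.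
apply: eq_bigr => j _; rewrite muE lamE; congr (_ *: _).
by field; have := m3 => ?; rewrite !gt_eqF//; lra.
Qed.

Lemma bold_R_sub (x y : 'I_m -> X) :
  bold_R lam x - bold_R lam y = bold_R lam (x - y).
Proof.
apply/funext => i; rewrite /bold_R fctE -sumrB.
by apply: eq_bigr => j _; rewrite scalerBr.
Qed.

(** [bold_R] has the eigenvalue [1] on the diagonal and [- r] on its orthogonal
    complement, where [r = (m - 1)^-1]. It is therefore averaged with constant
    [(1 - r) / (1 + r) = (m - 2) / m], which is at least [3^-1] as [3 <= m]. *)
Lemma bold_R_averaged : averaged (@prod_ip R X m ip) 3^-1 (bold_R lam).
Proof.
move=> x y; rewrite bold_R_sub.
have -> : x - bold_R lam x - (y - bold_R lam y) = (x - y) - bold_R lam (x - y).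
  by rewrite -bold_R_sub subrBB_AC.
move: (x - y) => d {x y}; set s := \sum_j d j; set M : R := m%:R.
have M3 : 3 <= M := m3.
pose D := prod_ip ip d d; pose S := ip s s.
have sumd : \sum_(i < m) ip s (d i) = S by rewrite /S {2}/s linear_sumr.
have sums : \sum_(i < m) S = M * S by rewrite sumr_const card_ord -mulr_natl.
(* Cauchy-Schwarz for the sum of the components of [d] *)
have CS : S <= M * D.
  have : 0 <= \sum_(i < m) ip (M *: d i - s) (M *: d i - s).
    by apply: sumr_ge0 => i _; exact: dot_ge0.
  under eq_bigr do rewrite dot_sqrB dot_sqrZ dotZl (dotC ip _ s) mulrA.
  rewrite big_split sumrB /= -!mulr_sumr sumd sums -/(prod_ip ip d d) -/D.
  have -> : M ^+ 2 * D - 2 * M * S + M * S = M * (M * D - S) by ring.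
  by rewrite pmulr_rge0 ?subr_ge0//; lra.
have RdE : prod_ip ip (bold_R lam d) (bold_R lam d) =
    (M - 1)^-1 ^+ 2 * ((M - 2) * S + D).
  rewrite /prod_ip; under eq_bigr do rewrite bold_RE dot_sqrZ dot_sqrB.
  rewrite -mulr_sumr big_split sumrB /= -mulr_sumr sumd sums; congr (_ * _).
  by rewrite /D /prod_ip; ring.
have dRE : prod_ip ip (d - bold_R lam d) (d - bold_R lam d) =
    (M - 1)^-1 ^+ 2 * (M ^+ 2 * D - M * S).
  rewrite /prod_ip.
  have E i : (d - bold_R lam d) i = (M - 1)^-1 *: (M *: d i - s).
    rewrite !fctE bold_RE -/s -/M.
    have {1}-> : d i = (M - 1)^-1 *: ((M - 1) *: d i).
      by rewrite scalerA mulVf ?scale1r// gt_eqF//; lra.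
    by rewrite -scalerBr scalerBl scale1r opprB addrA subrK.
  under eq_bigr do rewrite E dot_sqrZ dot_sqrB dot_sqrZ dotZl (dotC ip _ s) mulrA.
  rewrite -mulr_sumr big_split sumrB /= -!mulr_sumr sumd sums; congr (_ * _).
  by rewrite -/(prod_ip ip d d) -/D; ring.
rewrite RdE dRE -/D mulrCA -mulrDr mulrC exprVn.
rewrite ler_pdivrMr ?exprn_gt0//; last lra.
rewrite -subr_ge0.
have -> : D * (M - 1) ^+ 2 -
    ((M - 2) * S + D + 3^-1 * (M ^+ 2 * D - M * S)) =
    (M * D - S) * (M - 2 - 3^-1 * M) by field.
by rewrite mulr_ge0//; lra.
Qed.

Lemma bold_J_firmly_nonexpansive (x y : 'I_m -> X)
    (J := bold_J lam A) :
  prod_ip ip (J x - J y) (J x - J y) <= prod_ip ip (J x - J y) (x - y).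
Proof.
apply: ler_sum => i _; apply: resolvent_firmly_nonexpansive => //.
by apply: maximally_monotone_scale => //; rewrite invr_gt0.
Qed.

Lemma bold_JR_averaged :
  averaged (@prod_ip R X m ip) 6^-1 (bold_J lam A \o bold_R lam).
Proof.
apply: firmly_nonexpansive_comp_averaged bold_R_averaged.
exact: bold_J_firmly_nonexpansive.
Qed.

Lemma bold_S_fixed_point (x : 'I_m -> X) :
  bold_S lam A x <-> x = (bold_J lam A \o bold_R lam) x.
Proof. by split=> [Sx|xE i]; [apply/funext => i; exact: Sx|rewrite {1}xE]. Qed.

(** The points of [bold_S] are the tuples of resolvents at their own mean. *)
Lemma bold_SP (x : 'I_m -> X) : bold_S lam A x <->
  forall i, x i = resolvent (A i) (\sum_(j < m) lam j *: x j).
Proof.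
have M0 : 0 < m%:R :> R by have := m3; lra.
have M1 : 0 < m%:R - 1 :> R by have := m3; lra.
suff H i : x i = resolvent (op_scale (Defs.mu lam i)^-1 (A i)) (bold_R lam x i)
    <-> x i = resolvent (A i) (\sum_(j < m) lam j *: x j).
  by split=> Sx i; apply/H; exact: Sx.
have maxS : maximally_monotone ip (op_scale (Defs.mu lam i)^-1 (A i)).
  by apply: maximally_monotone_scale; rewrite ?invr_gt0.
have mu0 : (Defs.mu lam i)^-1 != 0 by rewrite invr_eq0 gt_eqF.
have key : (Defs.mu lam i)^-1^-1 *: (bold_R lam x i - x i) =
    \sum_(j < m) lam j *: x j - x i.
  rewrite invrK bold_RE muE.
  under [in RHS]eq_bigr do rewrite lamE.
  rewrite -scaler_sumr; set s := \sum_j x j.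
  rewrite scalerBr !scalerA scalerBr -addrA -opprD -scalerDl.
  congr (_ *: _ - _); first by field; rewrite !gt_eqF.
  by rewrite -[RHS]scale1r; congr (_ *: _); field; rewrite !gt_eqF.
have PS := resolventP ip ip_norm _ (bold_R lam x i) (x i) maxS.
have PA := resolventP ip ip_norm _ (\sum_(j < m) lam j *: x j) (x i) (A_maxmon i).
split=> [/esym/PS/(op_scaleP _ _ _ _ mu0)|/esym/PA].
  by rewrite key => /PA.
by rewrite -key => /(op_scaleP _ _ _ _ mu0)/PS.
Qed.

Lemma bold_S_mean (x : 'I_m -> X) : bold_S lam A x ->
  Fix (J_avg lam A) (\sum_(i < m) lam i *: x i).
Proof.
move=> /bold_SP Sx; rewrite /Fix /= /J_avg.
by apply: eq_bigr => i _; rewrite -Sx.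
Qed.

Lemma Fix_J_avg_bold_S (z : X) : Fix (J_avg lam A) z ->
  bold_S lam A (fun i => resolvent (A i) z).
Proof. by rewrite /Fix /= => zE; apply/bold_SP => i; rewrite {1}zE. Qed.

End UniformWeights.

(** * The dichotomy *)

Theorem theorem4p1 (R : realType) (X : completeNormedModType R)
    (ip : {dot X for idfun})
    (ip_norm : forall x : X, `|x| = Num.sqrt (ip x x))
    (X_neq0 : exists x : X, x != 0)
    (m : nat) (m_ge3 : (3 <= m)%N)
    (A : 'I_m -> X -> set X)
    (A_maxmon : forall i, maximally_monotone ip (A i))
    (lam : 'I_m -> R) (lamE : forall i, lam i = 1 / m%:R)
    (x0 : 'I_m -> X) (x : nat -> 'I_m -> X)
    (x_0 : x 0%N = x0)
    (x_S : forall n, x n.+1 = (bold_J lam A \o bold_R lam) (x n)) :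
  exactly_one
    (Fix (J_avg lam A) !=set0 /\
     exists xx : 'I_m -> X,
       [/\ bold_S lam A xx,
           weak_cvg (prod_ip ip) x xx,
           weak_cvg ip (fun n => \sum_(i < m) lam i *: x n i)
                       (\sum_(i < m) lam i *: xx i) &
           Fix (J_avg lam A) (\sum_(i < m) lam i *: xx i)])
    (Fix (J_avg lam A) = set0 /\
     prod_norm ip (x n) @[n --> \oo] --> +oo).
Proof.
have wuc := prod_weakly_ultracompact m ip (hilbert_weakly_ultracompact ip ip_norm).
have avg := bold_JR_averaged ip ip_norm lam A m_ge3 lamE A_maxmon.
have k_gt0 : 0 < 6^-1 :> R by rewrite invr_gt0.
split; last by move=> [[[z Fz] _] [F0 _]]; rewrite F0 in Fz.
have [F0|/eqP/set0P Fn0] := pselect (Fix (J_avg lam A) = set0).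
  right; split=> //; apply: (averaged_norm_cvgy _ _ _ k_gt0 avg x x_S wuc).
  move=> c /bold_S_fixed_point Sc.
  suff : (set0 : set X) (\sum_(i < m) lam i *: c i) by [].
  by rewrite -F0; exact: bold_S_mean Sc.
left; split=> //; have [z Fz] := Fn0.
have /bold_S_fixed_point fixz :=
  Fix_J_avg_bold_S ip ip_norm lam A m_ge3 lamE A_maxmon z Fz.
have [xx [/bold_S_fixed_point Sxx xxx]] :=
  averaged_weak_cvg _ _ _ k_gt0 avg x x_S _ wuc fixz.
exists xx; split=> //; last exact: bold_S_mean Sxx.
move=> y.
have E (u : 'I_m -> X) :
    ip (\sum_(i < m) lam i *: u i) y = prod_ip ip u (fun i => lam i *: y).
  rewrite linear_sumlz; apply: eq_bigr => i _.
  by rewrite /= dotZl dotZr.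
rewrite E; under eq_fun do rewrite E.
exact: xxx.
Qed.
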